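(* Let $T$ be a domain, $M$ a maximal ideal of $T$, $\varphi:T\to k:=T/M$ the natural projection, $D$ a proper subring of $k$, and $R=\varphi^{-1}(D)$. Then $R$ is $t$-super potent if and only if $D$ is $t$-super potent and not a field, and each maximal $t$-ideal of $T$ not contained in $M$ is $t$-super potent.
   Context: For a domain $R$ with quotient field $K$ and a nonzero fractional ideal $I$ of $R$, put $I^{-1}=\{x\in K: xI\subseteq R\}$, $I^v=(I^{-1})^{-1}$, and $I^t=\bigcup J^v$, the union over all nonzero finitely generated subideals $J$ of $I$. A $t$-ideal is a nonzero ideal $I$ with $I^t=I$. A maximal $t$-ideal is an ideal of $R$ maximal among the proper $t$-ideals. A nonzero ideal $I$ is $t$-invertible if $(II^{-1})^t=R$. A nonzero finitely generated ideal $I$ of $R$ is $t$-super rigid if it is contained in exactly one maximal $t$-ideal of $R$ and every finitely generated ideal $J\supseteq I$ of $R$ is $t$-invertible. A maximal $t$-ideal of $R$ is $t$-super potent if it contains a $t$-super rigid ideal, and $R$ is $t$-super potent if each of its maximal $t$-ideals is $t$-super potent. The same definitions are applied to the domains $D$ and $T$.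
   Formalization: The formal theorem adds the hypothesis that R is not a field; this excludes exactly M = 0 with D a field (e.g. T the reals, D the rationals), where R has no maximal t-ideal and is vacuously t-super potent while D is a field, so the stated equivalence fails. *)

(* Defs.v *)
From HB Require Import structures.
From mathcomp Require Import all_boot all_order all_algebra.
From mathcomp Require Import ring_quotient fraction.
From mathcomp Require Import boolp classical_sets.

Set Implicit Arguments.
Unset Strict Implicit.
Unset Printing Implicit Defensive.

Import GRing.Theory.
Local Open Scope ring_scope.
Local Open Scope classical_set_scope.
Local Open Scope quotient_scope.

Local Notation "x %:F" := (@FracField.tofrac _ x).

Section TOperation.
Variable A : idomainType.
Local Notation K := {fraction A}.

Implicit Types (I J Q : set A) (E F : set K).

Definition nonzero_set (V : zmodType) (E : set V) : Prop :=
  exists2 x, E x & x != 0.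

Definition is_ideal I : Prop :=
  I 0 /\ forall a x y, I x -> I y -> I (a * x + y).

Definition ideal_span (s : seq A) : set A :=
  [set x | exists c : 'I_(size s) -> A, x = \sum_i c i * s`_i].

Definition fg_ideal I : Prop := exists s : seq A, I = ideal_span s.

(* The A-submodule of K generated by s. *)
Definition frac_span (s : seq K) : set K :=
  [set x | exists c : 'I_(size s) -> A, x = \sum_i (c i)%:F * s`_i].

(* An ideal of A, seen as a fractional ideal. *)
Definition frac_of I : set K := [set x%:F | x in I].

Definition frac_inv E : set K :=
  [set x | forall y, E y -> frac_of setT (x * y)].

Definition frac_mul E F : set K :=
  [set x | exists (n : nat) (e f : 'I_n -> K),
     [/\ forall i, E (e i), forall i, F (f i) & x = \sum_i e i * f i]].

Definition v_op E : set K := frac_inv (frac_inv E).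

Definition t_op E : set K :=
  [set x | exists s : seq K,
     [/\ nonzero_set (frac_span s), frac_span s `<=` E
       & v_op (frac_span s) x]].

Definition t_ideal I : Prop :=
  [/\ is_ideal I, nonzero_set I & t_op (frac_of I) = frac_of I].

Definition maximal_t_ideal Q : Prop :=
  [/\ t_ideal Q, Q <> setT
    & forall Q', t_ideal Q' -> Q' <> setT -> Q `<=` Q' -> Q' = Q].

Definition t_invertible I : Prop :=
  nonzero_set I /\
  t_op (frac_mul (frac_of I) (frac_inv (frac_of I))) = frac_of setT.

Definition t_super_rigid I : Prop :=
  [/\ fg_ideal I, nonzero_set I,
      exists! Q, maximal_t_ideal Q /\ I `<=` Q
    & forall J, fg_ideal J -> I `<=` J -> t_invertible J].

(* Only meaningful for a maximal t-ideal Q. *)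
Definition t_super_potent_ideal Q : Prop :=
  exists2 I, t_super_rigid I & I `<=` Q.

End TOperation.

Definition t_super_potent (A : idomainType) : Prop :=
  forall Q : set A, maximal_t_ideal Q -> t_super_potent_ideal Q.

(* A subring of a domain, as a domain in its own right: x is a unit when its
   inverse exists in the ambient domain and lies in the subring. *)
Section Subring.
Variables (A : idomainType) (S : subringClosed A).

Record subring_type := SubringElt {
  subring_val : A;
  _ : subring_val \in (S : {pred A})
}.

HB.instance Definition _ := [isSub for subring_val].
HB.instance Definition _ := [Choice of subring_type by <:].
HB.instance Definition _ := [SubChoice_isSubComNzRing of subring_type by <:].

Definition subring_unit : {pred subring_type} :=
  [pred x | (val x \is a GRing.unit) && ((val x)^-1 \in (S : {pred A}))].

Definition subring_inv (x : subring_type) : subring_type :=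
  insubd x (val x)^-1.

Fact subring_mulVx :
  {in subring_unit, left_inverse 1 subring_inv *%R}.
Proof.
move=> x /andP[ux ix]; apply: val_inj.
by rewrite rmorphM rmorph1 /= insubdK // mulVr.
Qed.

Fact subring_unitPl (x y : subring_type) : y * x = 1 -> subring_unit x.
Proof.
move/(congr1 val); rewrite rmorphM rmorph1 => yx.
have ux : val x \is a GRing.unit.
  by apply/unitrP; exists (val y); split=> //; rewrite mulrC.
rewrite /subring_unit inE ux /=.
have -> : (val x)^-1 = val y by apply: (mulIr ux); rewrite mulVr.
exact: valP.
Qed.

Fact subring_inv_out : {in [predC subring_unit], subring_inv =1 id}.
Proof.
move=> x; rewrite !inE negb_and /subring_inv => /orP[ux|ix].
  by rewrite invr_out // valKd.
by apply: val_inj; rewrite val_insubd (negbTE ix).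
Qed.

HB.instance Definition _ := GRing.ComNzRing_hasMulInverse.Build subring_type
  subring_mulVx subring_unitPl subring_inv_out.

Fact subring_integral : GRing.integral_domain_axiom subring_type.
Proof.
move=> x y /(congr1 val); rewrite rmorphM rmorph0 => /eqP.
by rewrite mulf_eq0 -!(inj_eq val_inj) rmorph0.
Qed.

HB.instance Definition _ :=
  GRing.ComUnitRing_isIntegral.Build subring_type subring_integral.

End Subring.

(* Boolean predicates are arbitrary subsets here (via asbool), so J ranges over
   all proper ideals. *)
Definition maximal_idealr_closed (R : nzRingType) (S : {pred R}) : Prop :=
  forall J : {pred R}, idealr_closed J -> {subset S <= J} -> {subset J <= S}.

HB.mixin Record isMaximalIdealrClosed (R : nzRingType) (S : R -> bool) := {
  maximal_idealr_closed_subproof : maximal_idealr_closed S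
}.

#[short(type="maximal_idealr")]
HB.structure Definition MaximalIdealr (R : nzRingType) :=
  {S of Idealr R S & isMaximalIdealrClosed R S}.

Section ResidueField.
Variables (T : comNzRingType) (M : maximal_idealr T).

Definition residue_field : Type := {ideal_quot M}.

HB.instance Definition _ := GRing.ComNzRing.on residue_field.

Definition residue (x : T) : residue_field := \pi_{ideal_quot M} x.

HB.instance Definition _ := GRing.RMorphism.copy residue (\pi_{ideal_quot M}).

Fact residue_surj (u : residue_field) : exists x, residue x = u.
Proof. by exists (repr (u : {ideal_quot M})); exact: reprK. Qed.

Fact residue_eq0 x : (residue x == 0) = (x \in (M : {pred T})).
Proof.
rewrite -(rmorph0 residue) /residue -[x in RHS]subr0.
by rewrite (Quotient.idealrBE M).
Qed.

Fact residue_has_inv (u : residue_field) : u != 0 -> exists v, v * u = 1.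
Proof.
have [x <-] := residue_surj u; rewrite residue_eq0 => xM.
pose J : {pred T} :=
  [pred z | `[< exists a m, m \in (M : {pred T}) /\ z = a * x + m >]].
have [J1|J1] := boolP (1 \in J).
  have [a [m [mM e]]] := asboolW J1; exists (residue a).
  move: mM; rewrite -residue_eq0 => /eqP m0.
  by rewrite -rmorphM -[LHS]addr0 -m0 -rmorphD -e rmorph1.
have JM : {subset J <= (M : {pred T})}.
  apply: maximal_idealr_closed_subproof.
    split=> //.
      by apply: asboolT; exists 0, 0; rewrite rpred0 mul0r addr0.
    move=> a u1 v1 /asboolW[b [m [mM ->]]] /asboolW[c [n [nM ->]]].
    apply: asboolT.
    exists (a * b + c), (a * m + n); split; first by rewrite rpredD ?idealMr.
    by rewrite mulrDr mulrDl mulrA addrACA.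
  move=> m mM; apply: asboolT; exists 0, m.
  by rewrite mul0r add0r.
case/negP: xM; apply/JM/asboolT.
by exists 1, 0; rewrite rpred0 mul1r addr0.
Qed.

Definition residue_inv (u : residue_field) : residue_field :=
  if pselect (exists v, v * u = 1) is left e then projT1 (cid e) else 0.

Fact residue_mulVf u : u != 0 -> residue_inv u * u = 1.
Proof.
move=> /residue_has_inv e; rewrite /residue_inv.
by case: pselect => // e'; case: cid.
Qed.

Fact residue_inv0 : residue_inv 0 = 0.
Proof.
rewrite /residue_inv; case: pselect => // e; exfalso; case: e => v.
by move/eqP; rewrite mulr0 eq_sym oner_eq0.
Qed.

HB.instance Definition _ :=
  GRing.ComNzRing_isField.Build residue_field residue_mulVf residue_inv0.

End ResidueField.

Section Pullback.
Variables (T : idomainType) (M : maximal_idealr T).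
Variable D : subringClosed (residue_field M).

Definition pullback_pred : {pred T} :=
  [pred x | residue M x \in (D : {pred residue_field M})].

Fact pullback_subring_closed : subring_closed pullback_pred.
Proof.
split=> [|x y|x y]; rewrite !inE ?rmorph1 ?rpred1 // => xD yD.
  by rewrite rmorphB rpredB.
by rewrite rmorphM rpredM.
Qed.

HB.instance Definition _ :=
  GRing.isSubringClosed.Build T pullback_pred pullback_subring_closed.

Definition pullback : idomainType := subring_type pullback_pred.

End Pullback.

(* Main.v *)
Require Import Defs.
From HB Require Import structures.
From mathcomp Require Import all_boot all_order all_algebra.
From mathcomp Require Import ring_quotient fraction.
From mathcomp Require Import boolp classical_sets.
From mathcomp Require Import ring.

(** Everything about t-ideals can be phrased by divisibility in the domain: x
lies in the v-closure of a finite list s when, for all a and all b != 0, b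
divides a x as soon as b divides every a y with y in s. A nonzero ideal is a
t-ideal when it is stable under the v-closures of its finite subsets
([t_idealP]), every proper t-ideal lies in a maximal one, which is prime, and a
finitely generated ideal J is t-invertible exactly when each maximal t-ideal P
misses some element of the product of J with its inverse
([t_invertible_span]). This turns t-super potency of a maximal t-ideal Q into a
statement about finite lists ([t_super_potent_idealP]): some list s in Q lies
in no other maximal t-ideal, and every list extending s has a fraction a / b
that multiplies it into the domain, but not into Q. The list s may be enlarged
at will inside Q, and this freedom is what makes the proof work.

The pullback is handled as a Cartesian square R -> T -> k, R -> D -> k. Its
conductor is M, the common kernel of R -> D and T -> k. The maximal t-ideals of
R split into two families.
 - Those containing M are the preimages of the maximal t-ideals P of D, if D is
   not a field ([maximal_t_ideal_above_conductor]). A fraction over D lifts to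
   an element of T, hence to a fraction over R. Conversely, once a list in R has
   an element q outside M, a fraction a / b multiplying the list into R becomes
   over D the fraction with denominator the image of q and numerator the image
   of (a / b) q. So t-super potency passes both ways between P and its preimage
   ([t_super_potent_proj_preimage]). From D to R, the list must also be kept out
   of the maximal t-ideals of the second family: adding to it some m in M with
   q y + m = 1, where y is in T, is enough.
 - Those not containing M are the contractions of the maximal t-ideals N of T
   with N not inside M ([maximal_t_ideal_not_above_conductor]). Multiplication
   by an m in M outside N moves elements and fractions of T into R and is
   harmless at N, since N is prime. Taking m with n + m = 1 and n in N, and
   putting n into the list, makes the lists over R and over T equivalent
   ([t_super_potent_contraction]).

It remains to see that D is not a field when R is t-super potent and not a
field ([residue_ring_not_field]). If D were a field, M would be a maximal
t-ideal of R. Take its list s and x in T with residue outside D, and extend s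
by x s, which still lies in M. A fraction that maps s and x s into R, but not
both into M, gives an element c of R with nonzero residue such that x c lies in
R, so the residue of x would be in the field D. *)

Set Implicit Arguments.
Unset Strict Implicit.
Unset Printing Implicit Defensive.

Import GRing.Theory.
Local Open Scope ring_scope.
Local Open Scope classical_set_scope.

Local Notation "x %:F" := (@FracField.tofrac _ x).

(** * Ideals and divisibility *)

Lemma seq_preimage (X Y : eqType) (f : X -> Y) (I : set X) (w : seq Y) :
  (forall y, y \in w -> (f @` I) y) ->
  exists2 s, w = map f s & forall x, x \in s -> I x.
Proof.
elim: w => [|z w IH] wI; first by exists [::].
have [y wy|s -> sI] := IH; first by apply: wI; rewrite in_cons wy orbT.
have [x Ix <-] := wI z (mem_head _ _).
by exists (x :: s) => // y; rewrite in_cons => /orP[/eqP ->|/sI].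
Qed.

Section Divisibility.
Variable A : idomainType.
Local Notation K := {fraction A}.
Implicit Types (I J P Q L : set A) (s w : seq A) (a b c x y : A).

Lemma is_ideal0 I : is_ideal I -> I 0. Proof. by case. Qed.

Lemma is_idealD I x y : is_ideal I -> I x -> I y -> I (x + y).
Proof. by move=> [_ H] Ix Iy; rewrite -[x]mul1r; apply: H. Qed.

Lemma is_idealMl I a x : is_ideal I -> I x -> I (a * x).
Proof. by move=> [I0 H] Ix; rewrite -[_ * _]addr0; apply: H. Qed.

Lemma is_idealMr I a x : is_ideal I -> I x -> I (x * a).
Proof. by rewrite mulrC; apply: is_idealMl. Qed.

Lemma ideal_sum I n (f : 'I_n -> A) : is_ideal I ->
  (forall i, I (f i)) -> I (\sum_i f i).
Proof.
move=> Iid If; apply: big_ind => //; first exact: is_ideal0.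
by move=> x y; apply: is_idealD.
Qed.

Lemma ideal_proper I : is_ideal I -> (I <> setT) <-> ~ I 1.
Proof.
move=> Iid; split=> [IT I1|I1 IT]; last by apply: I1; rewrite IT.
apply: IT; apply/seteqP; split=> // x _; rewrite -[x]mulr1.
exact: is_idealMl.
Qed.

Definition divides b x := exists c, x = b * c.

Lemma dividesD b x y : divides b x -> divides b y -> divides b (x + y).
Proof. by move=> [c ->] [d ->]; exists (c + d); rewrite mulrDr. Qed.

Lemma divides_mull b a x : divides b x -> divides b (a * x).
Proof. by move=> [c ->]; exists (a * c); rewrite mulrCA. Qed.

(** The trace on A of the v-closure of the fractional ideal spanned by s, with
the elements of the inverse written as fractions a / b ([v_op_span]). *)
Definition v_closure s : set A :=
  [set x | forall a b, b != 0 ->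
     (forall y, y \in s -> divides b (a * y)) -> divides b (a * x)].

Lemma sub_v_closure s x : x \in s -> v_closure s x.
Proof. by move=> sx a b _; apply. Qed.

Lemma v_closure_sub s w : (forall y, y \in s -> v_closure w y) ->
  v_closure s `<=` v_closure w.
Proof. by move=> sw x sx a b b0 wb; apply: sx => // y /sw; apply. Qed.

Lemma v_closure_subset s w : {subset s <= w} -> v_closure s `<=` v_closure w.
Proof. by move=> sw; apply: v_closure_sub => y /sw; apply: sub_v_closure. Qed.

Lemma v_closure_ideal s : is_ideal (v_closure s).
Proof.
split=> [a b _ _|a x y sx sy c b b0 sb].
  by exists 0; rewrite !mulr0.
rewrite mulrDr mulrCA; apply: dividesD; first exact/divides_mull/sx.
exact: sy.
Qed.

(** * The t-operation by divisibility *)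

Lemma fraction_quotient (y : K) : exists a b, b != 0 /\ y = a%:F / b%:F.
Proof.
elim/quotW: y => -[[a b] /= b0]; exists a, b; split=> //.
have bF : b%:F != 0 by rewrite tofrac_eq0.
apply: (canRL (mulfK bF)); rewrite !piE; apply/eqmodP.
rewrite /= FracField.equivfE /FracField.mulf /=.
rewrite !numden_Ratio ?mulf_neq0 ?denom_ratioP ?oner_neq0 //=.
by rewrite !mulr1 mulrC.
Qed.

Lemma frac_ofE I x : frac_of I x%:F <-> I x.
Proof.
split=> [[y Iy]|Ix]; last by exists x.
by move/eqP; rewrite tofrac_eq => /eqP <-.
Qed.

Lemma integral_quotient a b x : b != 0 ->
  frac_of setT (a%:F / b%:F * x%:F) <-> divides b (a * x).
Proof.
move=> b0; have bF : b%:F != 0 by rewrite tofrac_eq0.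
have e : b%:F * (a%:F / b%:F * x%:F) = (a * x)%:F.
  by rewrite rmorphM /= mulrA [b%:F * _]mulrCA mulfV // mulr1.
split=> [[c _ E]|[c E]].
  by exists c; apply/eqP; rewrite -tofrac_eq -e -E rmorphM.
by exists c => //; apply: (mulfI bF); rewrite e E rmorphM.
Qed.

Lemma span_sub_ideal I s : is_ideal I -> (forall y, y \in s -> I y) ->
  frac_span [seq y%:F | y <- s] `<=` frac_of I.
Proof.
move=> Iid sI z [c ->].
have {}sI (i : 'I_(size [seq y%:F | y <- s])) : I s`_i.
  by apply/sI/mem_nth; rewrite -(size_map (@FracField.tofrac A)).
exists (\sum_i c i * s`_i).
  by apply: ideal_sum => // i; apply: is_idealMl.
rewrite rmorph_sum; apply: eq_bigr => i _; rewrite rmorphM /=.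
rewrite -(nth_map 0 0 (@FracField.tofrac A)) //.
by rewrite -(size_map (@FracField.tofrac A)).
Qed.

Lemma mem_frac_span (w : seq K) (y : K) : y \in w -> frac_span w y.
Proof.
move=> wy; have iw : (index y w < size w)%N by rewrite index_mem.
exists (fun i => (i == Ordinal iw)%:R).
rewrite (bigD1 (Ordinal iw)) //= eqxx rmorph1 mul1r nth_index // big1 ?addr0 //.
by move=> i /negbTE ->; rewrite rmorph0 mul0r.
Qed.

Lemma frac_inv_span s (y : K) :
  frac_inv (frac_span [seq x%:F | x <- s]) y <->
  forall x, x \in s -> frac_of setT (y * x%:F).
Proof.
split=> [yI x sx|ys z [c ->]]; first by apply/yI/mem_frac_span/map_f.
rewrite mulr_sumr; apply: big_ind => [|u v [a _ <-] [b _ <-]|i _].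
- by exists 0 => //; rewrite rmorph0.
- by exists (a + b) => //; rewrite rmorphD.
have is_ : (i < size s)%N by rewrite -(size_map (@FracField.tofrac A)).
have [a _ e] := ys _ (mem_nth 0 is_).
by exists (c i * a) => //; rewrite (nth_map 0) // rmorphM /= e mulrCA.
Qed.

(** An element of the inverse of the span of s is a fraction a / b such that b
divides a y for every y in s; this translates the v-operation into
divisibility. *)
Lemma v_op_span s x :
  v_op (frac_span [seq y%:F | y <- s]) x%:F <-> v_closure s x.
Proof.
split=> [xv a b b0 bs|xv y].
  apply/integral_quotient => //; rewrite mulrC; apply/xv/frac_inv_span => y /bs.
  by move/integral_quotient; apply.
move/frac_inv_span; have [a [b [b0 ->]]] := fraction_quotient y => ys.
rewrite mulrC; apply/integral_quotient => //; apply: xv => // z /ys.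
by move/integral_quotient; apply.
Qed.

Lemma v_op_integral s (z : K) :
  v_op (frac_span [seq y%:F | y <- s]) z -> frac_of setT z.
Proof.
move=> zv; rewrite -[z]mulr1; apply/zv/frac_inv_span => x _.
by exists x => //; rewrite mul1r.
Qed.

Definition t_closure I : set A :=
  [set x | exists2 s, forall y, y \in s -> I y & v_closure s x].

(** The t-operation only involves spans of lists in I, hence it produces no
element outside A. Nonzeroness of the span is free: adding a nonzero element of
I to a list only enlarges its v-closure. *)
Lemma t_op_frac_of I : is_ideal I -> nonzero_set I ->
  t_op (frac_of I) = frac_of (t_closure I).
Proof.
move=> Iid [x0 Ix0 x00]; apply/seteqP.
split=> [z [w [_ wI zv]]|z [x [s sI sx] <-]].
  have [s e sI] : exists2 s, w = [seq y%:F | y <- s] & forall y, y \in s -> I y.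
    by apply: seq_preimage => y /mem_frac_span /wI.
  rewrite e in zv; have [x _ ex] := v_op_integral zv.
  by exists x => //; exists s => //; apply/v_op_span; rewrite ex.
have s'I y : y \in x0 :: s -> I y by rewrite in_cons => /orP[/eqP ->|/sI].
exists [seq y%:F | y <- x0 :: s]; split; last 1 first.
- apply/v_op_span; apply: v_closure_subset sx => y sy.
  by rewrite in_cons sy orbT.
- exists x0%:F; first by apply: mem_frac_span; apply: map_f (mem_head _ _).
  by rewrite tofrac_eq0.
- exact: span_sub_ideal.
Qed.

Lemma frac_of_inj I J : frac_of I = frac_of J -> I = J.
Proof.
by move=> e; apply/seteqP; split=> x; rewrite -2!frac_ofE e.
Qed.

Lemma sub_t_closure I : I `<=` t_closure I.
Proof.
move=> x Ix; exists [:: x]; first by move=> y; rewrite inE => /eqP ->.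
by apply: sub_v_closure; rewrite inE.
Qed.

Lemma t_idealP I : t_ideal I <->
  [/\ is_ideal I, nonzero_set I
    & forall s, (forall y, y \in s -> I y) -> v_closure s `<=` I].
Proof.
split=> [[Iid I0]|[Iid I0 It]].
  rewrite t_op_frac_of // => /frac_of_inj e; split=> // s sI x sx.
  by rewrite -e; exists s.
split=> //; rewrite t_op_frac_of //; congr frac_of; apply/seteqP.
by split=> [x [s /It]|]; [apply | apply: sub_t_closure].
Qed.

(** Idempotence holds because a finite list in the t-closure depends on finitely
many finite lists of I, which can be concatenated. *)
Lemma t_closure_t_ideal I : is_ideal I -> nonzero_set I ->
  t_ideal (t_closure I).
Proof.
move=> Iid [x0 Ix0 x00]; apply/t_idealP; split.
- split=> [|a x y [s sI sx] [w wI wy]].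
    by exists [::] => //; apply: is_ideal0 (v_closure_ideal _).
  exists (s ++ w) => [z|]; first by rewrite mem_cat => /orP[/sI|/wI].
  apply: (v_closure_ideal _).2.
    by apply: v_closure_subset sx => z; rewrite mem_cat => ->.
  by apply: v_closure_subset wy => z; rewrite mem_cat orbC => ->.
- by exists x0 => //; apply: sub_t_closure.
move=> s sI.
suff [w wI sw] : exists2 w, forall y, y \in w -> I y &
    forall y, y \in s -> v_closure w y.
  by move=> x /(v_closure_sub sw); exists w.
elim: s sI => [|y s IH] sI; first by exists [::].
have [z sz|w wI sw] := IH; first by apply: sI; rewrite in_cons sz orbT.
have [w' w'I w'y] := sI y (mem_head _ _).
exists (w' ++ w) => [z|z]; first by rewrite mem_cat => /orP[/w'I|/wI].
rewrite in_cons => /orP[/eqP ->|/sw].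
  by apply: v_closure_subset w'y => u; rewrite mem_cat => ->.
by apply: v_closure_subset => u; rewrite mem_cat orbC => ->.
Qed.

(** * Maximal t-ideals *)

(** Stability under v-closures only tests finite lists, and a finite list in the
union of a chain lies in one member. *)
Lemma t_ideal_bigcup (F : set (set A)) : F !=set0 -> F `<=` @t_ideal A ->
  total_on F subset -> t_ideal (\bigcup_(I in F) I).
Proof.
move=> [I0 FI0] Ft Fch.
have fin s : (forall y, y \in s -> (\bigcup_(I in F) I) y) ->
    exists2 I, F I & forall y, y \in s -> I y.
  elim: s => [|y s IH] sF; first by exists I0.
  have [z sz|I FI sI] := IH; first by apply: sF; rewrite in_cons sz orbT.
  have [J FJ Jy] := sF y (mem_head _ _).
  have [IJ|JI] := Fch _ _ FI FJ.
    by exists J => // z; rewrite in_cons => /orP[/eqP ->|/sI/IJ].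
  by exists I => // z; rewrite in_cons => /orP[/eqP ->|/sI//]; apply: JI.
have /t_idealP[I0id [x0 I0x x00] _] := Ft _ FI0.
apply/t_idealP; split.
- split=> [|a x y xF yF]; first by exists I0 => //; apply: is_ideal0.
  have [z|I FI sI] := fin [:: x; y].
    by rewrite !inE => /orP[] /eqP ->.
  exists I => //; have /t_idealP[[_ Iid] _ _] := Ft _ FI.
  by apply: Iid; apply: sI; rewrite !inE eqxx ?orbT.
- by exists x0 => //; exists I0.
move=> s /fin[I FI sI] x sx; exists I => //.
by have /t_idealP[_ _] := Ft _ FI; apply; eassumption.
Qed.

Lemma maximal_t_ideal_above I : t_ideal I -> I <> setT ->
  exists2 Q, maximal_t_ideal Q & I `<=` Q.
Proof.
move=> It IT.
(* The alternative J = set0 accounts for the union of the empty chain. *)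
pose ok J := J = set0 \/ [/\ t_ideal J, J <> setT & I `<=` J].
have Iok : ok I by right; split=> // x.
have [F Fok Fch|Q [Qok Qmax]] := Zorn_bigcup (P := ok).
  pose G := F `&` [set J | J <> set0].
  have GF : \bigcup_(J in G) J = \bigcup_(J in F) J.
    apply/seteqP; split=> x [J]; first by case=> FJ _ Jx; exists J.
    by move=> FJ Jx; exists J => //; split=> // J0; rewrite J0 in Jx.
  rewrite -GF.
  have [[J0 GJ0]|G0] := pselect (G !=set0); last first.
    left; apply/seteqP; split=> // x [J GJ _].
    by case: G0; exists J.
  have Gok J : G J -> [/\ t_ideal J, J <> setT & I `<=` J].
    by case=> /Fok[].
  have Gt : t_ideal (\bigcup_(J in G) J).
    apply: t_ideal_bigcup; first by exists J0.
      by move=> J /Gok[].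
    by move=> J J' [FJ _] [FJ' _]; apply: Fch.
  have /t_idealP[Gid _ _] := Gt; right; split=> //.
  - apply/ideal_proper => //.
    by case=> J /Gok[/t_idealP[Jid _ _] /(ideal_proper Jid)].
  - by have [_ _ IJ] := Gok _ GJ0; move=> x /IJ; exists J0.
have I_0 : I 0 by have /t_idealP[/is_ideal0] := It.
case: Qok => [Q0|[Qt QT IQ]].
  case: (Qmax I) => //; rewrite Q0; split=> [x []|e].
  by have := e 0 I_0.
exists Q => //; split=> // Q' Q't Q'T QQ'; apply/seteqP; split=> //.
apply: contrapT => Q'Q; apply: (Qmax Q'); first by split.
by right; split=> //; apply: subset_trans QQ'.
Qed.

Lemma maximal_t_idealP P : maximal_t_ideal P ->
  [/\ is_ideal P, nonzero_set P, ~ P 1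
    & forall s, (forall y, y \in s -> P y) -> v_closure s `<=` P].
Proof.
by case=> /t_idealP[Pid P0 Pv] /(ideal_proper Pid) P1 _.
Qed.

Lemma maximal_t_ideal_eq P I : maximal_t_ideal P -> t_ideal I -> ~ I 1 ->
  P `<=` I -> I = P.
Proof.
move=> [_ _ Pmax] It I1; apply: Pmax => //; apply/ideal_proper => //.
by case/t_idealP: It.
Qed.

(** The colon ideal of P by y is a t-ideal containing P. If y is not in P it is
proper, hence it equals P. *)
Lemma maximal_t_ideal_prime P x y : maximal_t_ideal P -> P (x * y) ->
  ~ P x -> P y.
Proof.
move=> Pm Pxy Px; apply: contrapT => Py.
have [Pid [x0 Px0 x00] P1 Pv] := maximal_t_idealP Pm.
apply: Px; pose I := [set z | P (z * y)].
rewrite -(@maximal_t_ideal_eq P I) //; last 2 first.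
- by rewrite /I /= mul1r.
- by move=> z Pz; apply: is_idealMr.
apply/t_idealP; split.
- split=> [|a u v Iu Iv]; rewrite /I /= ?mul0r; first exact: is_ideal0.
  by rewrite mulrDl -mulrA; apply: Pid.2.
- by exists x0 => //; apply: is_idealMr.
move=> s sI z sz; apply: (Pv [seq u * y | u <- s]).
  by move=> _ /mapP[u /sI Iu ->].
move=> a b b0 bs; rewrite mulrA mulrAC; apply: sz => // u su.
by rewrite mulrAC -mulrA; apply: bs; apply: map_f.
Qed.

(** * Invertibility at a maximal t-ideal *)

(** The ideal J spanned by w is invertible at P, that is, the product of J and
its inverse is not inside P: the fraction a / b is in the inverse of J, and its
product c with a generator is not in P. *)
Definition invertible_at P w := exists a b, [/\ b != 0,
  forall x, x \in w -> divides b (a * x)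
  & exists2 x, x \in w & exists2 c, a * x = b * c & ~ P c].

Lemma is_ideal_span s : is_ideal (ideal_span s).
Proof.
split=> [|a _ _ [c ->] [d ->]].
  by exists (fun=> 0); rewrite big1 // => i _; rewrite mul0r.
exists (fun i => a * c i + d i).
by rewrite mulr_sumr -big_split; apply: eq_bigr => i _; rewrite mulrDl mulrA.
Qed.

Lemma mem_ideal_span s x : x \in s -> ideal_span s x.
Proof.
move=> sx; have ix : (index x s < size s)%N by rewrite index_mem.
exists (fun i => (i == Ordinal ix)%:R).
rewrite (bigD1 (Ordinal ix)) //= eqxx mul1r nth_index // big1 ?addr0 //.
by move=> i /negbTE ->; rewrite mul0r.
Qed.

Lemma ideal_span_sub s I : is_ideal I ->
  ideal_span s `<=` I <-> (forall x, x \in s -> I x).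
Proof.
move=> Iid; split=> [sI x /mem_ideal_span/sI//|sI _ [c ->]].
by apply: ideal_sum => // i; apply: is_idealMl => //; apply/sI/mem_nth.
Qed.

Lemma divides_span s a b :
  (forall x, x \in s -> divides b (a * x)) ->
  forall x, ideal_span s x -> divides b (a * x).
Proof.
move=> bs _ [c ->]; rewrite mulr_sumr; apply: ideal_sum => [|i].
  by split=> [|d x y bx by_]; [exists 0; rewrite mulr0|
    apply: dividesD by_; apply: divides_mull].
by rewrite mulrCA; apply/divides_mull/bs/mem_nth.
Qed.

(** The elements that a / b multiplies into P; testing a fraction on
generators is enough because they form an ideal. *)
Lemma multiplier_ideal P a b : is_ideal P ->
  is_ideal [set t | exists2 c, a * t = b * c & P c].
Proof.
move=> Pid; split=> [|d t t' [c tc Pc] [c' tc' Pc']].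
  by exists 0; rewrite ?mulr0 //; apply: is_ideal0.
exists (d * c + c'); last exact: Pid.2.
by rewrite mulrDr mulrCA tc tc' mulrDr mulrCA.
Qed.

Lemma mul_quotient a b x c : b != 0 -> a * x = b * c ->
  c%:F = x%:F * (a%:F / b%:F).
Proof.
move=> b0 e; apply: (mulfI (_ : b%:F != 0)); first by rewrite tofrac_eq0.
rewrite -rmorphM -e rmorphM /= mulrCA [b%:F * _]mulrCA.
by rewrite mulfV ?mulr1 ?tofrac_eq0 // mulrC.
Qed.

(** The product of J and its inverse is an ideal L of A. Its t-closure is A
exactly when L lies in no maximal t-ideal, because a proper t-closure is a
t-ideal and is contained in a maximal one. *)
Lemma t_invertible_span s : nonzero_set (ideal_span s) ->
  t_invertible (ideal_span s) <->
  forall P, maximal_t_ideal P -> invertible_at P s.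
Proof.
set J := ideal_span s => J0; have Jid : is_ideal J by apply: is_ideal_span.
have J_inv a b : b != 0 -> (forall x, x \in s -> divides b (a * x)) ->
    frac_inv (frac_of J) (a%:F / b%:F).
  move=> b0 bs _ [x Jx <-]; apply/integral_quotient => //.
  exact: divides_span Jx.
pose L := [set x | frac_mul (frac_of J) (frac_inv (frac_of J)) x%:F].
have Lid : is_ideal L.
  split=> [|a x y [n [e [f [eJ fJ exy]]]] [m [e' [f' [eJ' fJ' exy']]]]].
    exists 0%N, (fun=> 0), (fun=> 0); rewrite big_ord0 rmorph0.
    by split=> // -[].
  exists (n + m)%N, (fun i => match split i with
      inl j => a%:F * e j | inr j => e' j end),
    (fun i => match split i with inl j => f j | inr j => f' j end).
  split=> [i|i|]; [case: split => j //|by case: split|].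
    have [z Jz <-] := eJ j; exists (a * z); first exact: is_idealMl.
    by rewrite rmorphM.
  rewrite rmorphD rmorphM /= exy exy' big_split_ord mulr_sumr.
  congr (_ + _); apply: eq_bigr => i _.
    by rewrite (unsplitK (inl i)) mulrA.
  by rewrite (unsplitK (inr i)).
have LE : frac_mul (frac_of J) (frac_inv (frac_of J)) = frac_of L.
  apply/seteqP; split=> [z zJ|_ [x Lx <-]//].
  have [x _ e] : frac_of setT z.
    case: zJ => n [e [f [eJ fJ ->]]].
    apply: big_ind => [|u v [a _ <-] [b _ <-]|i _].
    - by exists 0; rewrite ?rmorph0.
    - by exists (a + b); rewrite ?rmorphD.
    by rewrite mulrC; apply: fJ.
  by exists x; rewrite // /L /= e.
(* 1 is in the inverse of J. *)
have JL : J `<=` L.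
  move=> x Jx; exists 1%N, (fun=> x%:F), (fun=> 1); rewrite big_ord1 mulr1.
  split=> // _; first by exists x.
  by move=> _ [y Jy <-]; exists y; rewrite ?mul1r.
have L0 : nonzero_set L by case: J0 => x /JL; exists x.
have tL : t_ideal (t_closure L) by apply: t_closure_t_ideal.
have L_sub P : maximal_t_ideal P -> ~ invertible_at P s -> L `<=` P.
  move=> Pm nP x [n [e [f [eJ fJ ex]]]].
  have [Pid _ _ _] := maximal_t_idealP Pm.
  apply/frac_ofE; rewrite ex.
  apply: big_ind => [|u v [a Pa <-] [b Pb <-]|i _].
  - by exists 0; rewrite ?rmorph0 //; apply: is_ideal0.
  - by exists (a + b); rewrite ?rmorphD //; apply: is_idealD.
  have [z Jz <-] := eJ i; have := fJ i; set y := f i.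
  have [a [b [b0 ->]]] := fraction_quotient y => yJ.
  have bs x' : x' \in s -> divides b (a * x').
    move=> sx; apply/integral_quotient => //; apply: yJ.
    by exists x' => //; apply: mem_ideal_span.
  pose I := [set t | exists2 c, a * t = b * c & P c].
  have Iid : is_ideal I by apply: multiplier_ideal.
  have [c e' Pc] : I z.
    apply: (ideal_span_sub s Iid).2 Jz => t st; have [c e'] := bs t st.
    exists c => //; apply: contrapT => Pc; apply: nP.
    by exists a, b; split=> //; exists t => //; exists c.
  by exists c => //; apply: mul_quotient.
rewrite /t_invertible LE t_op_frac_of //.
split=> [[_ /frac_of_inj tL1] P Pm|sP].
  apply: contrapT => /(L_sub _ Pm) LP.
  have [_ _ P1 Pv] := maximal_t_idealP Pm.
  have [w wL w1] : t_closure L 1 by rewrite tL1.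
  by apply: P1; apply: Pv w1 => y /wL/LP.
split=> //; congr frac_of; apply: contrapT => /(maximal_t_ideal_above tL).
case=> P Pm LP; have [a [b [b0 bs [x sx [c e Pc]]]]] := sP P Pm.
apply/Pc/LP/sub_t_closure; exists 1%N, (fun=> x%:F), (fun=> a%:F / b%:F).
rewrite big_ord1; split=> [_|_|]; last 1 first.
- exact: mul_quotient.
- by exists x => //; apply: mem_ideal_span.
- exact: J_inv.
Qed.

(** A t-super rigid ideal inside Q, and every ideal above it, is invertible at
any other maximal t-ideal P, since it is not contained in P. So the condition
only concerns Q, and it may be tested on the lists that extend a fixed list of
generators. *)
Lemma t_super_potent_idealP Q : maximal_t_ideal Q ->
  t_super_potent_ideal Q <-> exists s, [/\ forall x, x \in s -> Q x,
    forall P, maximal_t_ideal P -> (forall x, x \in s -> P x) -> P = Q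
    & forall w, invertible_at Q (s ++ w)].
Proof.
move=> Qm; have [Qid [x0 Qx0 x00] Q1 _] := maximal_t_idealP Qm.
split=> [[I [[s ->] I0 [Q' [[Q'm IQ'] uQ]] Iinv] IQ]|[s [sQ uQ sinv]]].
  have sQ x : x \in s -> Q x by move/mem_ideal_span/IQ.
  exists s; split=> // [P Pm sP|w].
    have [Pid _ _ _] := maximal_t_idealP Pm.
    rewrite -(uQ Q) //; apply/esym/uQ; split=> //.
    exact/ideal_span_sub.
  have sub : ideal_span s `<=` ideal_span (s ++ w).
    apply/ideal_span_sub; first exact: is_ideal_span.
    by move=> x sx; apply: mem_ideal_span; rewrite mem_cat sx.
  have sw0 : nonzero_set (ideal_span (s ++ w)).
    by case: I0 => x /sub; exists x.
  by apply: (t_invertible_span sw0).1 => //; apply: Iinv => //; exists (s ++ w).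
(* A nonzero element of Q ensures that the spanned ideal is nonzero. *)
pose s' := s ++ [:: x0].
have s'Q x : x \in s' -> Q x by rewrite mem_cat inE => /orP[/sQ|/eqP ->].
exists (ideal_span s'); last exact/ideal_span_sub.
have s'0 : nonzero_set (ideal_span s').
  by exists x0 => //; apply: mem_ideal_span; rewrite mem_cat inE eqxx orbT.
split=> //; first by exists s'.
  exists Q; split=> [|P [Pm]].
    by split=> //; apply/ideal_span_sub.
  have [Pid _ _ _] := maximal_t_idealP Pm.
  move/(ideal_span_sub _ Pid) => sP; apply/esym/uQ => // x sx.
  by apply: sP; rewrite mem_cat sx.
move=> J [w ->] s'J.
have J0 : nonzero_set (ideal_span w) by case: s'0 => x /s'J; exists x.
apply/t_invertible_span => // P Pm.
have [Pid _ P1 _] := maximal_t_idealP Pm.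
have [wP|] := pselect (forall x, x \in w -> P x); last first.
  (* The ideal is not inside P, so the fraction 1 / 1 is suitable. *)
  case/existsNP=> x /not_implyP[wx Px]; exists 1, 1; split.
  - exact: oner_neq0.
  - by move=> y _; exists y; rewrite mul1r.
  - by exists x => //; exists x.
have PQ : P = Q.
  apply: uQ => // x sx; apply: (ideal_span_sub w Pid).2 => //.
  by apply/s'J/mem_ideal_span; rewrite mem_cat sx.
rewrite PQ; have [a [b [b0 bs [x sx [c e Qc]]]]] := sinv w.
have bw y : y \in w -> divides b (a * y).
  by move=> wy; apply: bs; rewrite mem_cat wy orbT.
exists a, b; split=> //; apply: contrapT => nw; apply: Qc.
(* The witness x of sinv may come from s; if all of w were multiplied into Q,
   so would be x, because s is in the span of w. *)
suff [d ed Qd] : exists2 d, a * x = b * d & Q d.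
  by rewrite (mulfI b0 (etrans (esym e) ed)).
pose I := [set t | exists2 d, a * t = b * d & Q d].
have Iid : is_ideal I by apply: multiplier_ideal.
have wI : ideal_span w `<=` I.
  apply/ideal_span_sub => // t wt; have [d ed] := bw t wt; exists d => //.
  by apply: contrapT => Qd; apply: nw; exists t => //; exists d.
apply: wI; move: sx; rewrite mem_cat => /orP[sx|]; last exact: mem_ideal_span.
by apply/s'J/mem_ideal_span; rewrite mem_cat sx.
Qed.
End Divisibility.

Lemma principal_t_ideal (A : idomainType) (d : A) : d != 0 ->
  t_ideal [set x | divides d x].
Proof.
move=> d0; apply/t_idealP; split.
- split=> [|a x y dx dy]; first by exists 0; rewrite mulr0.
  by apply: dividesD dy; apply: divides_mull.
- by exists d => //; exists 1; rewrite mulr1.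
move=> s sd x sx; rewrite /= -[x]mul1r; apply: sx => // y /sd.
by rewrite mul1r.
Qed.

Lemma not_field_t_ideal (A : idomainType) : ~ GRing.field_axiom A ->
  exists2 I : set A, t_ideal I & ~ I 1.
Proof.
case/existsNP=> d /not_implyP[d0 dU].
exists [set x | divides d x]; first exact: principal_t_ideal.
by move=> [c e]; apply: dU; apply/unitrPr; exists c.
Qed.

(** * Cartesian squares *)

Section CartesianSquare.
Variables (R T D : idomainType) (k : fieldType).
Variables (iota : {rmorphism R -> T}) (phi : {rmorphism T -> k}).
Variable (j : {rmorphism D -> k}).
Hypothesis iota_inj : injective iota.
Hypothesis j_inj : injective j.
Hypothesis phi_surj : forall u, exists x, phi x = u.
Hypothesis cartesian :
  forall x, (exists r, iota r = x) <-> (exists d, j d = phi x).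
Hypothesis j_not_surj : exists u, forall d, j d <> u.

Implicit Types (a b c m r : R) (x y z u : T) (d : D).
Implicit Types (P : set D) (Q : set R) (N : set T).

(** The fourth arrow R -> D of the square. It respects the operations because j
is injective. *)
Definition square_proj r : D :=
  projT1 (cid ((cartesian (iota r)).1 (ex_intro _ r erefl))).
Local Notation pi := square_proj.

Lemma square_projE r : j (pi r) = phi (iota r).
Proof. by rewrite /pi; case: cid. Qed.

Lemma square_proj_surj d : exists r, pi r = d.
Proof.
have [x ex] := phi_surj (j d).
have [r er] : exists r, iota r = x by apply/cartesian; exists d.
by exists r; apply: j_inj; rewrite square_projE er.
Qed.

Lemma square_projD a b : pi (a + b) = pi a + pi b.
Proof. by apply: j_inj; rewrite rmorphD !square_projE !rmorphD. Qed.

Lemma square_projM a b : pi (a * b) = pi a * pi b.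
Proof. by apply: j_inj; rewrite rmorphM !square_projE !rmorphM. Qed.

Lemma square_proj0 : pi 0 = 0.
Proof. by apply: j_inj; rewrite square_projE !rmorph0. Qed.

Lemma square_proj1 : pi 1 = 1.
Proof. by apply: j_inj; rewrite square_projE !rmorph1. Qed.

Lemma square_projN a : pi (- a) = - pi a.
Proof. by apply: j_inj; rewrite rmorphN !square_projE !rmorphN. Qed.

Lemma square_proj_eq0 r : pi r = 0 <-> phi (iota r) = 0.
Proof.
rewrite -square_projE; split=> [->|/eqP]; first by rewrite rmorph0.
by rewrite -(rmorph0 j) (inj_eq j_inj) => /eqP.
Qed.

Lemma cartesian_lift x d : phi x = j d -> exists2 r, iota r = x & pi r = d.
Proof.
move=> e.
have [r er] : exists r, iota r = x by apply/cartesian; exists d; rewrite e.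
by exists r => //; apply: j_inj; rewrite square_projE er.
Qed.

Lemma cartesian_lift_ker x : phi x = 0 -> exists2 r, iota r = x & pi r = 0.
Proof. by move=> e; apply: cartesian_lift; rewrite rmorph0. Qed.

Lemma iota_eq0 r : (iota r == 0) = (r == 0).
Proof. by rewrite -(rmorph0 iota) (inj_eq iota_inj). Qed.

(** When D is not all of k, this is the largest ideal of T inside R. *)
Definition conductor : set R := [set r | pi r = 0].

(** The kernel of T -> k is a maximal ideal, hence comaximal to any element
outside it. *)
Lemma comaximal_ker x : phi x != 0 ->
  exists y m, [/\ pi m = 0 & x * y + iota m = 1].
Proof.
move=> x0; have [y ey] := phi_surj (phi x)^-1.
have [m em m0] : exists2 m, iota m = 1 - x * y & pi m = 0.
  apply: cartesian_lift_ker.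
  by rewrite rmorphB rmorphM rmorph1 ey mulfV // subrr.
by exists y, m; split=> //; rewrite em addrC subrK.
Qed.

(** * t-ideals above the conductor *)

(** A fraction d / e of D, seen in k, lifts to an element y of T, and y is a
fraction a / b of R: with a nonzero element of the conductor as denominator, or,
if the conductor is zero, because R -> D is then bijective. *)
Lemma lift_quotient (d e : D) : e != 0 -> exists y a b,
  [/\ b != 0, iota b * y = iota a & phi y * j e = j d].
Proof.
move=> e0; have je0 : j e != 0 by rewrite -(rmorph0 j) (inj_eq j_inj).
have [y ey] := phi_surj (j d / j e).
have {}ey : phi y * j e = j d by rewrite ey mulfVK.
have [[m m0 mz]|M0] := pselect (exists2 m, m != 0 & pi m = 0).
  have [a ea _] : exists2 a, iota a = iota m * y & pi a = 0.
    apply: cartesian_lift_ker.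
    by rewrite rmorphM -square_projE mz rmorph0 mul0r.
  by exists y, a, m.
have [a ea] := square_proj_surj d; have [b eb] := square_proj_surj e.
exists y, a, b; split=> //.
  by apply: contra_neq e0 => b0; rewrite -eb b0 square_proj0.
have [m em m0] : exists2 m, iota m = iota b * y - iota a & pi m = 0.
  apply: cartesian_lift_ker.
  by rewrite rmorphB rmorphM -!square_projE eb ea mulrC ey subrr.
apply/eqP; rewrite -subr_eq0 -em iota_eq0; apply/negPn/negP => mz.
by apply: M0; exists m.
Qed.

(** If d / e multiplies the image of s into D, its lift y multiplies s into R,
because membership in R is decided by residues. Hence y multiplies into R any x
in the v-closure of s, and d / e multiplies the image of x into D. *)
Lemma t_ideal_proj_preimage P : t_ideal P -> t_ideal [set r | P (pi r)].
Proof.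
move=> /t_idealP[Pid [p0 Pp0 p00] Pv]; apply/t_idealP; split.
- split=> [|a x y Px Py]; rewrite /= ?square_proj0; first exact: is_ideal0.
  by rewrite square_projD square_projM; apply: Pid.2.
- have [r er] := square_proj_surj p0; exists r; first by rewrite /= er.
  by apply: contra_neq p00 => r0; rewrite -er r0 square_proj0.
move=> s sP x sx; apply: (Pv (map pi s)) => [_ /mapP[y /sP Py ->]//|].
move=> d e e0 ds; have [y [a [b [b0 eab ede]]]] := lift_quotient d e0.
have je0 : j e != 0 by rewrite -(rmorph0 j) (inj_eq j_inj).
have [r ss|c ec] := sx a b b0.
  have [c ec] := ds _ (map_f pi ss).
  have [c' ec' _] : exists2 c', iota c' = y * iota r & pi c' = c.
    apply: cartesian_lift; apply: (mulIf je0).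
    by rewrite rmorphM mulrAC ede -square_projE -!rmorphM ec mulrC.
  exists c'; apply: iota_inj; rewrite !rmorphM ec' -eab; ring.
have {}ec : y * iota x = iota c.
  apply: (mulfI (_ : iota b != 0)); first by rewrite iota_eq0.
  by rewrite mulrA eab -!rmorphM ec.
exists (pi c); apply: j_inj.
by rewrite !rmorphM !square_projE -ec rmorphM -ede; ring.
Qed.

Lemma conductor_sub_mem Q r r' : is_ideal Q -> conductor `<=` Q ->
  pi r = pi r' -> Q r -> Q r'.
Proof.
move=> Qid cQ e Qr; rewrite -[r'](subrK r) addrC.
apply: is_idealD => //; apply: cQ.
by rewrite /conductor /= square_projD square_projN e subrr.
Qed.

(** Let the image of s be a list in the image of Q. Adding to s the element r0,
outside the conductor, and some m of the conductor with r0 y0 + m = 1 forces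
every fraction y that multiplies the list into R to lie in T. Such a y has a
residue, which is a fraction over D with denominator the residue of r0. *)
Lemma t_ideal_proj_image Q r0 : t_ideal Q -> conductor `<=` Q -> Q r0 ->
  pi r0 != 0 -> t_ideal (pi @` Q).
Proof.
move=> /t_idealP[Qid _ Qv] cQ Qr0 r00; apply/t_idealP; split.
- split=> [|d _ _ [x Qx <-] [y Qy <-]].
    by exists 0; rewrite ?square_proj0 //; apply: is_ideal0.
  have [a <-] := square_proj_surj d; exists (a * x + y); first exact: Qid.2.
  by rewrite square_projD square_projM.
- by exists (pi r0) => //; exists r0.
move=> w wQ d wd; have [r er] := square_proj_surj d; exists r => //.
have [s ew sQ] := seq_preimage wQ.
have phi0 : phi (iota r0) != 0 by apply: contra_neq r00 => /square_proj_eq0.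
have [y0 [m [m0 eym]]] := comaximal_ker phi0.
apply: (Qv (r0 :: m :: s)) => [t|a b b0 bs].
  by rewrite !in_cons => /or3P[/eqP ->|/eqP ->|/sQ] //; apply: cQ.
have [c0 ec0] : divides b (a * r0) by apply: bs; rewrite mem_head.
have [c1 ec1] : divides b (a * m) by apply: bs; rewrite !in_cons eqxx orbT.
have ib0 : iota b != 0 by rewrite iota_eq0.
have [y ey] : exists y, iota a = iota b * y.
  exists (iota c0 * y0 + iota c1).
  rewrite mulrDr mulrA -!rmorphM -ec0 -ec1 !rmorphM.
  by rewrite -mulrA -mulrDr eym mulr1.
have yE t c : a * t = b * c -> y * iota t = iota c.
  move=> e; apply: (mulfI ib0); rewrite mulrA -ey -!rmorphM e //.
have [e ee] : divides (pi r0) (pi c0 * d).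
  apply: wd => // u; rewrite ew => /mapP[t st ->].
  have [c ec] : divides b (a * t) by apply: bs; rewrite !in_cons st !orbT.
  exists (pi c); rewrite -!square_projM; congr pi; apply: (mulfI b0).
  by rewrite mulrA -ec0 [RHS]mulrCA -ec; ring.
have [c ec _] : exists2 c, iota c = y * iota r & pi c = e.
  apply: cartesian_lift; apply: (mulfI phi0).
  have := congr1 j ee; rewrite !rmorphM !square_projE -(yE _ _ ec0) -er.
  by rewrite square_projE => <-; rewrite rmorphM; ring.
by exists c; apply: iota_inj; rewrite !rmorphM ec ey; ring.
Qed.

(** * t-ideals not above the conductor *)

Definition contraction N : set R := [set r | N (iota r)].

(** The elements of T that multiply the conductor into Q. For Q prime and not
above the conductor this is the only prime of T with contraction Q. *)
Definition extension Q : set T :=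
  [set x | forall r c, pi c = 0 -> iota r = x * iota c -> Q r].

Local Notation M := [set x : T | phi x = 0].

Lemma conductor_mul x c : pi c = 0 ->
  exists2 r, iota r = x * iota c & pi r = 0.
Proof.
move=> /square_proj_eq0 c0; apply: cartesian_lift_ker.
by rewrite rmorphM c0 mulr0.
Qed.

(** Both n and m are elements of R, so that a decomposition of 1 in T between N
and the conductor is available inside R. *)
Lemma comaximal_conductor N : is_ideal N -> ~ N 1 -> ~ N `<=` M ->
  exists n m, [/\ N (iota n), ~ N (iota m), pi m = 0 & n + m = 1].
Proof.
move=> Nid N1 /existsNP[x /not_implyP[Nx /eqP/comaximal_ker[y [m [m0 e]]]]].
have Nn : N (iota (1 - m)).
  by rewrite rmorphB rmorph1 -e addrK; apply: is_idealMr.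
exists (1 - m), m; split=> //; last by rewrite subrK.
move=> Nm; apply: N1; rewrite -(rmorph1 iota) -[1](subrK m) rmorphD.
exact: is_idealD.
Qed.

(** If a / b multiplies s into T, then m a / b multiplies s into R, and
m a / b = m^2 a / (m b) is a fraction over R. So the v-closure over R of a list
s in R is multiplied by m into its v-closure over T; as m is outside the prime
N, this factor can be removed. *)
Lemma contraction_t_ideal N : maximal_t_ideal N -> ~ N `<=` M ->
  t_ideal (contraction N).
Proof.
move=> Nm NM; have [Nid _ N1 Nv] := maximal_t_idealP Nm.
have [n [m [Nn Nim m0 nm1]]] := comaximal_conductor Nid N1 NM.
have im0 : iota m != 0.
  by apply/eqP => e; apply: Nim; rewrite e; apply: is_ideal0.
apply/t_idealP; split.
- split=> [|a x y Nx Ny]; rewrite /contraction /= ?rmorph0.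
    exact: is_ideal0.
  by rewrite rmorphD rmorphM; apply: Nid.2.
- exists n => //; apply: contraNneq (oner_neq0 D) => n0.
  by rewrite -square_proj1 -nm1 n0 add0r m0.
move=> s sN x sx; apply: (maximal_t_ideal_prime Nm _ Nim).
apply: (Nv (map iota s)) => [_ /mapP[y /sN Ny ->]//|a b b0 bs].
have [b' eb' _] : exists2 b', iota b' = b * iota m & pi b' = 0.
  exact: conductor_mul.
have [a' ea' _] : exists2 a', iota a' = a * iota m * iota m & pi a' = 0.
  exact: conductor_mul.
have b'0 : b' != 0 by rewrite -iota_eq0 eb' mulf_neq0.
have [t st|c ec] := sx a' b' b'0.
  have [c ec] := bs _ (map_f iota st).
  have [c' ec' _] := conductor_mul c m0.
  exists c'; apply: iota_inj; rewrite !rmorphM ea' eb' ec'.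
  have -> : a * iota m * iota m * iota t = a * iota t * iota m * iota m by ring.
  by rewrite ec; ring.
exists (iota c); apply: (mulfI im0).
have := congr1 iota ec; rewrite !rmorphM ea' eb' => e.
have -> : iota m * (b * iota c) = b * iota m * iota c by ring.
by rewrite -e; ring.
Qed.

Lemma sub_extension Q : is_ideal Q -> Q `<=` contraction (extension Q).
Proof.
move=> Qid q Qq r c _; rewrite -rmorphM => /iota_inj ->.
exact: is_idealMr.
Qed.

Lemma conductor_sub_extension1 Q : extension Q 1 -> conductor `<=` Q.
Proof. by move=> Q1 c c0; apply: (Q1 c c) => //; rewrite mul1r. Qed.

(** For c in the conductor, the list s c lies in Q. A fraction multiplying s c
into R multiplies x c into T, and x c m into R for m in the conductor; if m is
outside the prime Q this factor can be removed. *)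
Lemma extension_t_ideal Q : maximal_t_ideal Q -> ~ conductor `<=` Q ->
  t_ideal (extension Q).
Proof.
move=> Qm; have [Qid [q Qq q0] _ Qv] := maximal_t_idealP Qm.
move=> /existsNP[m /not_implyP[m0 Qm0]].
apply/t_idealP; split.
- split=> [|x y z Qy Qz] r c c0.
    by rewrite mul0r => /eqP; rewrite iota_eq0 => /eqP ->; apply: is_ideal0.
  have [c' ec' c'0] := conductor_mul x c0.
  have [r1 e1 _] := conductor_mul y c'0; have [r2 e2 _] := conductor_mul z c0.
  have -> : (x * y + z) * iota c = iota (r1 + r2).
    by rewrite rmorphD e1 e2 ec'; ring.
  by move=> /iota_inj ->; apply: is_idealD => //; [apply: Qy e1|apply: Qz e2].
- by exists (iota q); [apply: sub_extension|rewrite iota_eq0].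
move=> s sQ x sx r c c0 er.
have [t /mapP[y ys ->]|s' es' s'Q] :=
    @seq_preimage _ _ iota Q [seq y * iota c | y <- s].
  have [r' er' _] := conductor_mul y c0.
  by exists r' => //; apply: sQ er'.
apply: (maximal_t_ideal_prime Qm _ Qm0); apply: (Qv s') => // a b b0 bs.
have ib0 : iota b != 0 by rewrite iota_eq0.
have [y ys|z ez] := sx (iota a * iota c) (iota b) ib0.
  have : y * iota c \in map iota s' by rewrite -es'; apply: map_f.
  case/mapP=> t st et; have [e ee] := bs t st.
  by exists (iota e); rewrite -mulrA [_ * y]mulrC et -!rmorphM ee.
have [e ee _] := conductor_mul z m0.
exists e; apply: iota_inj; rewrite !rmorphM ee er [RHS]mulrA -ez; ring.
Qed.

Lemma extensionK Q : maximal_t_ideal Q -> ~ conductor `<=` Q ->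
  contraction (extension Q) = Q.
Proof.
move=> Qm; have [Qid _ _ _] := maximal_t_idealP Qm.
move=> /existsNP[m /not_implyP[m0 Qm0]].
apply/seteqP; split; last exact: sub_extension.
move=> r Qr; apply: (maximal_t_ideal_prime Qm _ Qm0).
by apply: (Qr _ m) => //; rewrite rmorphM mulrC.
Qed.

Lemma contractionK N : maximal_t_ideal N -> ~ N `<=` M ->
  extension (contraction N) = N.
Proof.
move=> Nm NM; have [Nid _ N1 Nv] := maximal_t_idealP Nm.
have [_ [m [_ Nim m0 _]]] := comaximal_conductor Nid N1 NM.
apply/seteqP; split=> [x Nx|x Nx r c _ er].
  have [r er _] := conductor_mul x m0.
  apply: (maximal_t_ideal_prime Nm _ Nim).
  by rewrite mulrC -er; apply: Nx er.
by rewrite /contraction /= er; apply: is_idealMr.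
Qed.

Lemma is_ideal_conductor : is_ideal conductor.
Proof.
split=> [|a x y]; rewrite /conductor /= ?square_proj0 //.
by rewrite square_projD square_projM => -> ->; rewrite mulr0 addr0.
Qed.

Lemma conductor1 : ~ conductor 1.
Proof. by rewrite /conductor /= square_proj1 => /eqP; rewrite oner_eq0. Qed.

(** The conductor is even a v-ideal: all of T multiplies it into R, whereas for
x in R with nonzero residue some w in T has w x outside R. *)
Lemma conductor_t_ideal : nonzero_set conductor -> t_ideal conductor.
Proof.
move=> [m m0 mn0]; apply/t_idealP; split; first exact: is_ideal_conductor.
  by exists m.
move=> s sc x sx; apply: contrapT => /square_proj_eq0/eqP x0.
(* w x has residue u, so it is not in R. *)
have [u uD] := j_not_surj; have [w ew] := phi_surj (u / phi (iota x)).
have [a ea _] := conductor_mul w m0.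
have [t st|c ec] := sx a m mn0.
  have [e ee _] := conductor_mul w (sc _ st).
  by exists e; apply: iota_inj; rewrite !rmorphM ea ee; ring.
apply: (uD (pi c)); rewrite square_projE.
have -> : iota c = w * iota x; last by rewrite rmorphM ew mulfVK.
apply: (mulfI (_ : iota m != 0)); first by rewrite iota_eq0.
by rewrite -rmorphM -ec rmorphM ea; ring.
Qed.

(** A maximal t-ideal Q above the contraction of N contains n with n + m = 1, so
it is not above the conductor; its extension is a proper t-ideal containing N,
hence it is N. *)
Lemma maximal_t_ideal_contraction N : maximal_t_ideal N -> ~ N `<=` M ->
  maximal_t_ideal (contraction N).
Proof.
move=> Nm NM; have [Nid _ N1 Nv] := maximal_t_idealP Nm.
have Qt := contraction_t_ideal Nm NM.
have [Qid _ _] := (t_idealP _).1 Qt.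
split=> //; first by apply/ideal_proper; rewrite // /contraction /= rmorph1.
move=> Q' Q't Q'T QQ'; have [Q Qm Q'Q] := maximal_t_ideal_above Q't Q'T.
have [Q_id _ Q1 _] := maximal_t_idealP Qm.
have cQ : ~ conductor `<=` Q.
  move=> cQ; have [n [m [Nn _ m0 nm1]]] := comaximal_conductor Nid N1 NM.
  by apply: Q1; rewrite -nm1; apply: is_idealD => //; [apply/Q'Q/QQ'|apply: cQ].
apply/seteqP; split=> //; suff -> : contraction N = Q by [].
rewrite -(extensionK Qm cQ); congr contraction; apply/esym.
apply: (maximal_t_ideal_eq Nm (extension_t_ideal Qm cQ)).
  by move/conductor_sub_extension1.
by rewrite -{1}(contractionK Nm NM) => x Nx r c c0 er; apply/Q'Q/QQ'/(Nx r c).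
Qed.

(** The extension of Q is not inside M, for otherwise Q would be strictly inside
the conductor, a proper t-ideal. Any larger proper t-ideal of T lies in a
maximal one, whose contraction contains, hence equals, Q. *)
Lemma maximal_t_ideal_not_above_conductor Q : maximal_t_ideal Q ->
  ~ conductor `<=` Q ->
  exists N, [/\ maximal_t_ideal N, ~ N `<=` M & Q = contraction N].
Proof.
move=> Qm cQ; have [Qid [q Qq q0] Q1 _] := maximal_t_idealP Qm.
have Nt := extension_t_ideal Qm cQ; have [Nid _ _] := (t_idealP _).1 Nt.
have QE := extensionK Qm cQ.
have NM : ~ extension Q `<=` M.
  move=> NM; have Qc : Q `<=` conductor.
    by rewrite -QE => r Nr; apply/square_proj_eq0/NM.
  apply: cQ; rewrite -(maximal_t_ideal_eq Qm (conductor_t_ideal _)) //.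
    by exists q => //; apply: Qc.
  exact: conductor1.
exists (extension Q); split=> //; split=> //.
  by apply/ideal_proper => // /conductor_sub_extension1.
move=> N1 N1t N1T NN1; have [N2 N2m N12] := maximal_t_ideal_above N1t N1T.
have N2M : ~ N2 `<=` M by move=> N2M; apply: NM => x Nx; apply/N2M/N12/NN1.
apply/seteqP; split=> // x /N12; rewrite -(contractionK N2m N2M).
rewrite (_ : contraction N2 = Q) //; apply: (maximal_t_ideal_eq Qm).
- exact: contraction_t_ideal.
- by rewrite /contraction /= rmorph1; case/maximal_t_idealP: N2m.
by rewrite -{1}QE => r Nr; apply/N12/NN1.
Qed.

(** * The residue ring is not a field *)

(** If D is a field, the conductor is a maximal t-ideal. Let s be its list from
t-super potency and x in T with residue u outside D; the list x s lies again in
the conductor. A fraction a / b for s followed by x s yields r in s with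
c1 = (a / b) r and c2 = x c1 both in R, with nonzero residues, and then u is the
residue of c2 / c1. *)
Lemma residue_ring_not_field : t_super_potent R -> ~ GRing.field_axiom R ->
  ~ GRing.field_axiom D.
Proof.
move=> Rsp Rf Df.
have inv r : pi r != 0 -> exists r', pi (r * r') = 1.
  move=> r0; have /unitrPr[d e] := Df _ r0; have [r' er'] := square_proj_surj d.
  by exists r'; rewrite square_projM er'.
have c0 : nonzero_set conductor.
  apply: contrapT => c0; apply: Rf => r r0.
  have [|r' e] := inv r.
    by apply: contraPneq c0 => pr0; rewrite not_notE; exists r.
  apply/unitrPr; exists r'; apply: contrapT => e'; apply: c0.
  exists (r * r' - 1); last by rewrite subr_eq0; apply/eqP.
  by rewrite /conductor /= square_projD square_projN e square_proj1 subrr.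
have ct := conductor_t_ideal c0.
have cm : maximal_t_ideal conductor.
  split=> //; first by move=> e; apply: conductor1; rewrite e.
  move=> Q Qt QT cQ; have [Qid _ _] := (t_idealP _).1 Qt.
  apply/seteqP; split=> // r Qr; apply: contrapT => /eqP/inv[r' e].
  apply: ((ideal_proper Qid).1 QT).
  apply: (conductor_sub_mem Qid cQ (r := r * r')).
    by rewrite e square_proj1.
  exact: is_idealMr.
have [s [sc _ sinv]] := (t_super_potent_idealP cm).1 (Rsp _ cm).
have [u uD] := j_not_surj; have [x ex] := phi_surj u.
have [t /mapP[r rs ->]|w ew wc] :=
    @seq_preimage _ _ iota conductor [seq x * iota r | r <- s].
  have [r' er' r'0] := conductor_mul x (sc _ rs).
  by exists r'.
have [a [b [b0 bs [t swt [c ec c_n0]]]]] := sinv w.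
suff [r [c1 [c2 [sr e1 e2 cn0]]]] : exists r c1 c2,
    [/\ r \in s, a * r = b * c1, iota a * (x * iota r) = iota b * iota c2
      & ~ (pi c1 = 0 /\ pi c2 = 0)].
  have e12 : iota c2 = x * iota c1.
    apply: (mulfI (_ : iota b != 0)); first by rewrite iota_eq0.
    by rewrite -e2 mulrCA -rmorphM e1 rmorphM mulrCA.
  have c1n0 : pi c1 != 0.
    apply/eqP => c10; apply: cn0; split=> //; apply/square_proj_eq0.
    by rewrite e12 rmorphM ((square_proj_eq0 _).1 c10) mulr0.
  have [c1' e] := inv _ c1n0; apply: (uD (pi (c2 * c1'))).
  rewrite square_projE rmorphM e12 -ex -[RHS]mulr1 -(rmorph1 j) -e square_projE.
  by rewrite !rmorphM mulrA.
have lift r : r \in s -> exists2 r', r' \in w & iota r' = x * iota r.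
  move=> sr; have : x * iota r \in map iota w.
    by rewrite -ew; apply: (map_f (fun r => x * iota r)).
  by case/mapP=> r' wr' ->; exists r'.
move: swt; rewrite mem_cat => /orP[st|wt].
  have [r' wr' er'] := lift t st.
  have [|c2 e2] := bs r'; first by rewrite mem_cat wr' orbT.
  exists t, c, c2; split=> //; last by case.
  by rewrite -er' -!rmorphM e2.
have : iota t \in [seq x * iota r | r <- s] by rewrite ew; apply: map_f.
case/mapP=> r sr er; have [|c1 e1] := bs r; first by rewrite mem_cat sr.
exists r, c1, c; split=> //; last by case.
by rewrite -er -!rmorphM ec.
Qed.


(** * Transfer of t-super potency *)

(** Fix n in N and m in the conductor with n + m = 1. Each x in T equals
m x + n x, so a list containing n spans over T the same ideal when its other
elements x are replaced by m x, which lie in R. A maximal t-ideal containing n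
is not inside M, respectively not above the conductor, so the correspondence
with the other ring applies to it. *)
Lemma t_super_potent_contraction N : maximal_t_ideal N -> ~ N `<=` M ->
  t_super_potent_ideal (contraction N) <-> t_super_potent_ideal N.
Proof.
move=> Nm NM; have [Nid _ N1 _] := maximal_t_idealP Nm.
have Qm := maximal_t_ideal_contraction Nm NM.
have [n [m [Nn Nim m0 nm1]]] := comaximal_conductor Nid N1 NM.
have im0 : iota m != 0.
  by apply/eqP => e; apply: Nim; rewrite e; apply: is_ideal0.
have inm1 : iota n + iota m = 1 by rewrite -rmorphD nm1 rmorph1.
have splitE x : x = iota m * x + x * iota n.
  by rewrite [iota m * x]mulrC -mulrDr addrC inm1 mulr1.
have not_sub_M I : is_ideal I -> I (iota n) -> ~ I `<=` M.
  move=> Iid In IM; have := oner_neq0 D.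
  rewrite -square_proj1 -nm1 square_projD m0 addr0.
  by move/eqP; apply; apply/square_proj_eq0/IM.
have scale (s : seq T) : exists w, [seq x * iota m | x <- s] = map iota w.
  have [_ /mapP[x _ ->]|w ew _] :=
      @seq_preimage _ _ iota setT [seq x * iota m | x <- s].
    by have [r er _] := conductor_mul x m0; exists r.
  by exists w.
split=> [/(t_super_potent_idealP Qm)|/(t_super_potent_idealP Nm)].
  case=> s [sQ uQ sinv]; apply/(t_super_potent_idealP Nm).
  exists (map iota (rcons s n)); split=> [_ /mapP[r sr ->]|N' N'm sN'|w].
  - by move: sr; rewrite mem_rcons in_cons => /orP[/eqP ->|/sQ].
  - have [N'id _ _ _] := maximal_t_idealP N'm.
    have N'M : ~ N' `<=` M.
      by apply: not_sub_M => //; apply/sN'/map_f; rewrite mem_rcons mem_head.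
    rewrite -(contractionK Nm NM) -(contractionK N'm N'M); congr extension.
    apply: uQ; first exact: maximal_t_ideal_contraction.
    by move=> r sr; apply/sN'/map_f; rewrite mem_rcons in_cons sr orbT.
  have [w' ew] := scale w.
  have [a [b [b0 bs [t swt [c ec Nc]]]]] := sinv (n :: w').
  have [cn ecn] : divides b (a * n).
    by apply: bs; rewrite mem_cat mem_head orbT.
  exists (iota a), (iota b); split; first by rewrite iota_eq0.
    move=> x; rewrite mem_cat => /orP[/mapP[r sr ->]|wx].
      have [|e ee] := bs r; last by exists (iota e); rewrite -!rmorphM ee.
      move: sr; rewrite mem_rcons !(in_cons, mem_cat).
      by case/orP=> ->; rewrite ?orbT.
    have : x * iota m \in map iota w'.
      by rewrite -ew; apply: (map_f (fun x => x * iota m)).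
    case/mapP=> r wr er; have [|e ee] := bs r.
      by rewrite mem_cat in_cons wr !orbT.
    exists (iota e + x * iota cn); rewrite mulrDr mulrCA -!rmorphM -ee -ecn.
    by rewrite {1}(splitE x) !rmorphM -er; ring.
  move: swt; rewrite mem_cat in_cons => /orP[st|/orP[/eqP et|wt]].
  - exists (iota t); last by exists (iota c); rewrite // -!rmorphM ec.
    by rewrite mem_cat map_f // mem_rcons in_cons st orbT.
  - exists (iota t); last by exists (iota c); rewrite // -!rmorphM ec.
    by rewrite mem_cat map_f // mem_rcons in_cons et eqxx.
  have : iota t \in [seq x * iota m | x <- w] by rewrite ew; apply: map_f.
  case/mapP=> x wx ex; exists x; first by rewrite mem_cat wx orbT.
  have : divides (iota b) (iota a * x).
    exists (iota c + x * iota cn); rewrite mulrDr mulrCA -!rmorphM -ec -ecn.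
    by rewrite {1}(splitE x) !rmorphM ex; ring.
  case=> c'' ec''; exists c'' => // Nc''; apply: Nc; rewrite /contraction /=.
  suff -> : iota c = c'' * iota m by apply: is_idealMr.
  apply: (mulfI (_ : iota b != 0)); first by rewrite iota_eq0.
  by rewrite -rmorphM -ec rmorphM ex mulrA ec'' mulrA.
case=> s [sN uN sinv]; apply/(t_super_potent_idealP Qm).
have [w ew] := scale s.
have sw r : r \in w -> exists2 x, x \in s & iota r = x * iota m.
  move=> wr; have : iota r \in [seq x * iota m | x <- s] by rewrite ew map_f.
  by case/mapP=> x; exists x.
have ws x : x \in s -> exists2 r, r \in w & iota r = x * iota m.
  move=> sx; have : x * iota m \in map iota w.
    by rewrite -ew; apply: (map_f (fun x => x * iota m)).
  by case/mapP=> r wr ->; exists r.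
exists (n :: w); split=> [r|Q' Q'm wQ'|w'].
- rewrite in_cons => /orP[/eqP ->//|/sw[x /sN Nx e]].
  by rewrite /contraction /= e; apply: is_idealMr.
- have [Q'id _ Q'1 _] := maximal_t_idealP Q'm.
  have Q'n : Q' n by apply: wQ'; rewrite mem_head.
  have cQ' : ~ conductor `<=` Q'.
    by move=> cQ'; apply: Q'1; rewrite -nm1; apply: is_idealD => //; apply: cQ'.
  have [N' [N'm _ e]] := maximal_t_ideal_not_above_conductor Q'm cQ'.
  have [N'id _ _ _] := maximal_t_idealP N'm.
  rewrite e; congr contraction; apply: uN => // x sx; rewrite (splitE x).
  have [r wr er] := ws x sx; have : Q' r by apply: wQ'; rewrite in_cons wr orbT.
  rewrite e /contraction /= er mulrC => N'mx; apply: is_idealD => //.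
  by apply: is_idealMl => //; rewrite -[N' _]/(contraction N' n) -e.
have [a [b [b0 bs [x swx [c ec Nc]]]]] := sinv (map iota (n :: w')).
(* The fraction m^2 a / (m b) over R equals m a / b. *)
have [a' ea' _] := conductor_mul (a * iota m) m0.
have [b' eb' _] := conductor_mul b m0.
have b'0 : b' != 0 by rewrite -iota_eq0 eb' mulf_neq0.
have lift r e : a * iota r = b * e ->
    exists2 e', a' * r = b' * e' & iota e' = e * iota m.
  move=> er; have [e' ee' _] := conductor_mul e m0; exists e' => //.
  apply: iota_inj; rewrite !rmorphM ea' eb' ee'.
  have -> : a * iota m * iota m * iota r = a * iota r * iota m * iota m by ring.
  by rewrite er; ring.
exists a', b'; split=> //.
  move=> r; rewrite mem_cat in_cons -orbA => /or3P[rw|/sw[y sy er]|rw].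
  - have [|e ee] := bs (iota r).
      by rewrite mem_cat (eqP rw) map_f ?mem_head ?orbT.
    by have [e' ee' _] := lift _ _ ee; exists e'.
  - have [|e ee] := bs y; first by rewrite mem_cat sy.
    have [|e' ee' _] := lift r (e * iota m); last by exists e'.
    by rewrite er mulrA ee mulrA.
  have [|e ee] := bs (iota r).
    by rewrite mem_cat map_f ?orbT // in_cons rw orbT.
  by have [e' ee' _] := lift _ _ ee; exists e'.
have mulm_notin z : ~ N z -> ~ N (z * iota m).
  by rewrite mulrC => Nz /(maximal_t_ideal_prime Nm)/(_ Nim).
move: swx; rewrite mem_cat => /orP[sx|/mapP[r rw er]].
  have [r wr er] := ws x sx; have [|e' ee' ie'] := lift r (c * iota m).
    by rewrite er mulrA ec mulrA.
  exists r; first by rewrite mem_cat in_cons wr orbT.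
  exists e' => //; rewrite /contraction /= ie'.
  exact/mulm_notin/mulm_notin.
have [|e' ee' ie'] := lift r c; first by rewrite -er.
exists r.
  by move: rw; rewrite mem_cat !in_cons => /orP[->|->]; rewrite ?orbT.
by exists e' => //; rewrite /contraction /= ie'; apply: mulm_notin.
Qed.

Hypothesis D_not_field : ~ GRing.field_axiom D.

(** The preimage of P is strictly above the conductor, as P is nonzero. So any
t-ideal containing it is the preimage of its image, again a t-ideal. *)
Lemma maximal_t_ideal_proj_preimage P : maximal_t_ideal P ->
  maximal_t_ideal [set r | P (pi r)].
Proof.
move=> Pm; have [Pid [p0 Pp0 p00] P1 _] := maximal_t_idealP Pm.
have Pt : t_ideal P by case: Pm.
have Qt := t_ideal_proj_preimage Pt.
have Qid : is_ideal [set r | P (pi r)] by have /t_idealP[] := Qt.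
split=> //; first by apply/ideal_proper => //; rewrite /= square_proj1.
move=> Q' Q't Q'T QQ'; have Q'id : is_ideal Q' by have /t_idealP[] := Q't.
have cQ' : conductor `<=` Q'.
  by move=> r r0; apply: QQ'; rewrite /= r0; apply: is_ideal0.
have [r0 er0] := square_proj_surj p0.
have Q'r0 : Q' r0 by apply: QQ'; rewrite /= er0.
have P't : t_ideal (pi @` Q').
  by apply: (t_ideal_proj_image Q't cQ' Q'r0); rewrite er0.
apply/seteqP; split=> // r Q'r /=.
rewrite -(maximal_t_ideal_eq Pm P't); first by exists r.
  case=> r1 Q'r1; rewrite -square_proj1.
  move=> /(conductor_sub_mem Q'id cQ')/(_ Q'r1).
  exact/ideal_proper.
move=> d Pd; have [r' er'] := square_proj_surj d; exists r' => //.
by apply: QQ'; rewrite /= er'.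
Qed.

(** The conductor itself is not a maximal t-ideal: a proper t-ideal of D, which
exists because D is not a field, has a strictly larger proper preimage. *)
Lemma maximal_t_ideal_above_conductor Q : maximal_t_ideal Q ->
  conductor `<=` Q -> exists2 P, maximal_t_ideal P & Q = [set r | P (pi r)].
Proof.
move=> Qm cQ; have [Qid _ Q1 _] := maximal_t_idealP Qm.
have Qt : t_ideal Q by case: Qm.
have [r0 Qr0 r00] : exists2 r0, Q r0 & pi r0 != 0.
  apply: contrapT => Q0; have [I It I1] := not_field_t_ideal D_not_field.
  have /t_idealP[Iid [d Id d0] _] := It.
  have [r er] := square_proj_surj d.
  apply: (Q0); exists r; last by rewrite er.
  rewrite -(maximal_t_ideal_eq Qm (t_ideal_proj_preimage It)) /=;
    rewrite ?er ?square_proj1 //.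
  move=> t Qt' /=; suff -> : pi t = 0 by apply: is_ideal0.
  by apply: contrapT => /eqP t0; apply: Q0; exists t.
have Pt := t_ideal_proj_image Qt cQ Qr0 r00.
have P1 : ~ (pi @` Q) 1.
  case=> r Qr; rewrite -square_proj1 => /(conductor_sub_mem Qid cQ) /(_ Qr) //.
have QE : [set r | (pi @` Q) (pi r)] = Q.
  apply/seteqP; split=> [r [r' Qr' e]|r Qr]; last by exists r.
  exact: conductor_sub_mem Qr'.
exists (pi @` Q) => //; split=> //; first by move=> e; apply: P1; rewrite e.
move=> P' P't P'T QP'.
have P'1 : ~ P' 1 by have /t_idealP[P'id _ _] := P't; apply/ideal_proper.
apply/seteqP; split=> // d; have [r <-] := square_proj_surj d => P'r.
exists r => //.
rewrite -(maximal_t_ideal_eq Qm (t_ideal_proj_preimage P't)) //=.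
  by rewrite square_proj1.
by move=> t Qt'; apply: QP'; exists t.
Qed.

(** Let q be a lift of a nonzero element of P. From R to D, adding q to the list
allows the fraction a / b to be replaced by cq / q with cq = (a / b) q, and the
residue of this makes sense. From D to R, the residue fraction is lifted to T,
and m in the conductor with q y0 + m = 1 is added to the list: no proper ideal
of T contains both q and m, hence neither does a maximal t-ideal of R that is
not above the conductor. *)
Lemma t_super_potent_proj_preimage P : maximal_t_ideal P ->
  t_super_potent_ideal [set r | P (pi r)] <-> t_super_potent_ideal P.
Proof.
move=> Pm; have Qm := maximal_t_ideal_proj_preimage Pm.
have [Pid [p0 Pp0 p00] _ _] := maximal_t_idealP Pm.
have [q eq] := square_proj_surj p0.
split=> [/(t_super_potent_idealP Qm)|/(t_super_potent_idealP Pm)].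
  case=> s [sQ uQ sinv]; apply/(t_super_potent_idealP Pm).
  exists (map pi (rcons s q)); split=> [_ /mapP[r sr ->]|P' P'm sP'|w].
  - by move: sr; rewrite mem_rcons in_cons => /orP[/eqP ->|/sQ//]; rewrite eq.
  - have e : [set r | P' (pi r)] = [set r | P (pi r)].
      apply: uQ; first exact: maximal_t_ideal_proj_preimage.
      by move=> r sr; apply/sP'/map_f; rewrite mem_rcons in_cons sr orbT.
    by apply/seteqP; split=> d; have [r <-] := square_proj_surj d => Pr;
      [rewrite -[P _]/([set r | P (pi r)] r) -e
      |rewrite -[P' _]/([set r | P' (pi r)] r) e].
  have [w' ew _] : exists2 w', w = map pi w' & forall r, r \in w' -> setT r.
    apply: seq_preimage => d _; have [r er] := square_proj_surj d.
    by exists r.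
  rewrite {w}ew -map_cat cat_rcons.
  have [a [b [b0 bs [t swt [c ec Pc]]]]] := sinv (q :: w').
  have [cq ecq] : divides b (a * q).
    by apply: bs; rewrite mem_cat in_cons eqxx orbT.
  have project r e : a * r = b * e -> pi cq * pi r = pi q * pi e.
    move=> er; rewrite -!square_projM; congr pi; apply: (mulfI b0).
    by rewrite mulrA -ecq [RHS]mulrCA -er; ring.
  exists (pi cq), (pi q); split; first by rewrite eq.
    move=> _ /mapP[r /bs[e er] ->]; exists (pi e); exact: project.
  exists (pi t); first exact: map_f.
  by exists (pi c) => //; apply: project.
case=> w [wP uP winv]; apply/(t_super_potent_idealP Qm).
have [s ew _] : exists2 s, w = map pi s & forall r, r \in s -> setT r.
  apply: seq_preimage => d _; have [r er] := square_proj_surj d.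
  by exists r.
have phiq0 : phi (iota q) != 0.
  by apply: contra_neq p00 => /square_proj_eq0; rewrite eq.
have [y0 [m [m0 eym]]] := comaximal_ker phiq0.
exists (s ++ [:: q; m]); split=> [r|Q' Q'm sQ'|w'].
- rewrite mem_cat !inE => /or3P[sr|/eqP ->|/eqP ->] /=; rewrite ?eq ?m0 //.
    by apply: wP; rewrite ew; apply: map_f.
  exact: is_ideal0.
- have [Q'id _ _ _] := maximal_t_idealP Q'm.
  have cQ' : conductor `<=` Q'.
    apply: contrapT => cQ'.
    have [N [Nm NM e]] := maximal_t_ideal_not_above_conductor Q'm cQ'.
    have [Nid _ N1 _] := maximal_t_idealP Nm; apply: N1; rewrite -eym.
    apply: is_idealD => //; first apply: is_idealMr => //.
      rewrite -[N _]/(contraction N q) -e; apply: sQ'.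
      by rewrite mem_cat !inE eqxx orbT.
    rewrite -[N _]/(contraction N m) -e; apply: sQ'.
    by rewrite mem_cat !inE eqxx !orbT.
  have [P' P'm e] := maximal_t_ideal_above_conductor Q'm cQ'.
  rewrite e; suff -> : P' = P by [].
  apply: uP => // d; rewrite ew => /mapP[r sr ->].
  by rewrite -[P' _]/([set r | P' (pi r)] r) -e; apply: sQ'; rewrite mem_cat sr.
have [d [e [e0 ds [t swt [f ef Pf]]]]] := winv (map pi ([:: q; m] ++ w')).
have {ds} ds r : r \in (s ++ [:: q; m]) ++ w' -> divides e (d * pi r).
  by move=> sr; apply: ds; rewrite ew -map_cat catA; apply: map_f.
have [y [a [b [b0 eab ede]]]] := lift_quotient d e0.
have je0 : j e != 0 by rewrite -(rmorph0 j) (inj_eq j_inj).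
have lift r g : d * pi r = e * g -> exists2 c, a * r = b * c & pi c = g.
  move=> er; have [c ec ecg] : exists2 c, iota c = y * iota r & pi c = g.
    apply: cartesian_lift; apply: (mulIf je0).
    by rewrite rmorphM mulrAC ede -square_projE -!rmorphM er mulrC.
  by exists c => //; apply: iota_inj; rewrite !rmorphM ec -eab; ring.
exists a, b; split=> // [r /ds[g /lift[c ec _]]|]; first by exists c.
move: swt; rewrite ew -map_cat catA => /mapP[r sr er].
rewrite er in ef; have [c ec ecf] := lift r f ef.
by exists r => //; exists c => //=; rewrite ecf.
Qed.
End CartesianSquare.

Theorem t_super_potent_cartesian_square (R T D : idomainType) (k : fieldType)
    (iota : {rmorphism R -> T}) (phi : {rmorphism T -> k})
    (j : {rmorphism D -> k}) :
  injective iota -> injective j -> (forall u, exists x, phi x = u) ->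
  (forall x, (exists r, iota r = x) <-> (exists d, j d = phi x)) ->
  (exists u, forall d, j d <> u) -> ~ GRing.field_axiom R ->
  t_super_potent R <->
  [/\ t_super_potent D, ~ GRing.field_axiom D
    & forall N : set T, maximal_t_ideal N -> ~ N `<=` [set x | phi x = 0] ->
        t_super_potent_ideal N].
Proof.
move=> ii ji ps cart js Rf; split=> [Rsp|[Dsp Df Tsp] Q Qm].
  have Df := residue_ring_not_field ii ji ps cart js Rsp Rf.
  split=> // [P Pm|N Nm NM].
    apply/(t_super_potent_proj_preimage ii ji ps cart js Df Pm)/Rsp.
    exact: maximal_t_ideal_proj_preimage.
  apply/(t_super_potent_contraction ii ji ps cart js Nm NM)/Rsp.
  exact: (maximal_t_ideal_contraction ii ji ps cart Nm NM).
have [cQ|cQ] := pselect (conductor cart `<=` Q).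
  have [P Pm ->] := maximal_t_ideal_above_conductor ii ji ps Df Qm cQ.
  by apply/(t_super_potent_proj_preimage ii ji ps cart js Df Pm)/Dsp.
have [N [Nm NM ->]] :=
  maximal_t_ideal_not_above_conductor ii ji ps js Qm cQ.
by apply/(t_super_potent_contraction ii ji ps cart js Nm NM)/Tsp.
Qed.

(* If T and D are both fields, then R = D is a field: it has no maximal t-ideal,
   so it is vacuously t-super potent, while the right-hand side fails because D
   is a field.  The hypothesis HR excludes exactly this case (it follows from
   T not being a field). *)
Theorem theorem4p4 (T : idomainType) (M : maximal_idealr T)
    (D : subringClosed (residue_field M))
    (HD : exists u : residue_field M, u \notin D)
    (HR : ~ GRing.field_axiom (pullback D)) :
  t_super_potent (pullback D) <->
  [/\ t_super_potent (subring_type D),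
      ~ GRing.field_axiom (subring_type D)
    & forall Q : set T, maximal_t_ideal Q -> ~ (Q `<=` [set` M]) ->
        t_super_potent_ideal Q].
Proof.
have ME : [set x | residue M x = 0] = [set` M].
  by apply/seteqP; split=> x; rewrite /= -residue_eq0 => /eqP.
rewrite -ME.
apply: (t_super_potent_cartesian_square (iota := \val) (phi := residue M)
  (j := \val)) => //.
- exact: val_inj.
- exact: val_inj.
- exact: residue_surj.
- move=> x; split=> [[r <-]|[d e]].
    have rD : residue M (val r) \in (D : {pred residue_field M}).
      exact: (valP r).
    by exists (SubringElt rD).
  have xR : x \in pullback_pred D by rewrite inE -e; apply: valP.
  by exists (SubringElt xR).
- by have [u uD] := HD; exists u => d e; case/negP: uD; rewrite -e; apply: valP.
Qed.
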